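(* Let $\bar A$ be an algebra. Suppose $\Omega:\bar A\to\underline{A}$ is an algebra epimorphism onto an algebra $\underline{A}$ of dimension $m\ge1$ whose left regular representation is self-adjoint (closed under transpose) as a subalgebra of $M_m(\mathbb{R})$, and let $\underline{\mathcal{I}}$ be the isomorphism from $\underline{A}$ onto its left regular representation. Then $\bar s\mapsto[\det(\underline{\mathcal{I}}\,\Omega\bar s)]^{1/m}$ (for $\bar s$ near $\mathbf{1}_{\bar A}$) is a special unital norm of $\bar A$. Moreover, at least one such epimorphism $\Omega$ exists for every algebra $\bar A$.
   Context: An ''algebra'' is a real finite-dimensional unital associative algebra with underlying vector space $\mathbb{R}^n$ ($n\ge1$), standard basis, elements column vectors $s$, $\mathbf{d}s$ the column of coordinate differentials, ''$\cdot$'' the Euclidean dot product, $\|\mathbf{1}\|^2=\mathbf{1}\cdot\mathbf{1}$. An uncurling metric is a real symmetric $n\times n$ matrix $L$ with $d\big((s^{-1})^TL\,\mathbf{d}s\big)=0$ on an open ball centered at $\mathbf{1}$ consisting only of units. A normalized uncurling metric is an uncurling metric $L$ with $s^TLs^{-1}=\|\mathbf{1}\|^2$ near $\mathbf{1}$. The unital norm associated with $L$ is $\ell(s)=\exp\!\big(\frac{1}{\|\mathbf{1}\|^2}\int_{\mathbf{1}}^s[Lt^{-1}]\cdot\mathbf{d}t\big)$ near $\mathbf{1}$; a special unital norm is the unital norm associated with a normalized uncurling metric. *)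

(* Defs.v *)
From HB Require Import structures.
From mathcomp Require Import all_boot all_order all_algebra.
From mathcomp Require Import all_classical all_reals all_analysis.
Set Implicit Arguments. Unset Strict Implicit. Unset Printing Implicit Defensive.
Import Order.TTheory GRing.Theory Num.Theory.
Import numFieldNormedType.Exports.
Local Open Scope classical_set_scope.
Local Open Scope ring_scope.

Section Algebras.
Variable R : realType.

Definition is_algebra (n : nat) (mul : 'cV[R]_n -> 'cV[R]_n -> 'cV[R]_n)
    (one : 'cV[R]_n) : Prop :=
  [/\ (0 < n)%N,
      (forall (c : R) (x y a : 'cV[R]_n), mul (c *: x + y) a = c *: mul x a + mul y a),
      (forall (c : R) (x y a : 'cV[R]_n), mul a (c *: x + y) = c *: mul a x + mul a y),
      (forall x y z : 'cV[R]_n, mul x (mul y z) = mul (mul x y) z) &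
      (forall x : 'cV[R]_n, mul one x = x /\ mul x one = x)].

Definition is_unit (n : nat) (mul : 'cV[R]_n -> 'cV[R]_n -> 'cV[R]_n)
    (one : 'cV[R]_n) (s : 'cV[R]_n) : Prop :=
  exists t, mul s t = one /\ mul t s = one.

(* the (two-sided) inverse s^{-1} of a unit s (an arbitrary value otherwise) *)
Definition ainv (n : nat) (mul : 'cV[R]_n -> 'cV[R]_n -> 'cV[R]_n)
    (one : 'cV[R]_n) (s : 'cV[R]_n) : 'cV[R]_n :=
  xget s [set t | mul s t = one /\ mul t s = one].

Definition dotv (n : nat) (u v : 'cV[R]_n) : R := \sum_(i < n) u i 0 * v i 0.

Definition ebasis (n : nat) (k : 'I_n) : 'cV[R]_n := delta_mx k 0.

(* uncurling metric: L symmetric and the 1-form (s^{-1})^T L ds, whose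
   j-th coefficient is (L s^{-1})_j, is closed (d = 0, i.e. its partial
   derivatives are symmetric) on an open ball centered at 1 consisting
   only of units. *)
Definition uncurling_metric (n : nat) (mul : 'cV[R]_n -> 'cV[R]_n -> 'cV[R]_n)
    (one : 'cV[R]_n) (L : 'M[R]_n) : Prop :=
  L^T = L /\
  exists2 r : R, 0 < r &
    forall s : 'cV[R]_n, ball one r s ->
      is_unit mul one s /\
      forall j k : 'I_n,
        'D_(ebasis k) (fun t : 'cV[R]_n => (L *m ainv mul one t) j 0) s =
        'D_(ebasis j) (fun t : 'cV[R]_n => (L *m ainv mul one t) k 0) s.

Definition normalized_uncurling_metric (n : nat)
    (mul : 'cV[R]_n -> 'cV[R]_n -> 'cV[R]_n) (one : 'cV[R]_n) (L : 'M[R]_n) : Prop :=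
  uncurling_metric mul one L /\
  \forall s \near one, ((s^T *m L *m ainv mul one s) 0 0 = dotv one one).

(* unital norm associated with L: exp( 1/||1||^2 * int_1^s [L t^{-1}] . dt ),
   the line integral taken along the straight segment t = 1 + tau (s - 1),
   tau in [0,1] (the form is closed on a ball around 1, so this is the
   path-independent value near 1). *)
Definition unital_norm (n : nat) (mul : 'cV[R]_n -> 'cV[R]_n -> 'cV[R]_n)
    (one : 'cV[R]_n) (L : 'M[R]_n) (s : 'cV[R]_n) : R :=
  expR ((dotv one one)^-1 *
    \int[lebesgue_measure]_(tau in `[0%R, 1%R])
       dotv (L *m ainv mul one (one + tau *: (s - one))) (s - one)).

Definition special_unital_norm (n : nat) (mul : 'cV[R]_n -> 'cV[R]_n -> 'cV[R]_n)
    (one : 'cV[R]_n) (f : 'cV[R]_n -> R) : Prop :=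
  exists L : 'M[R]_n, normalized_uncurling_metric mul one L /\
    \forall s \near one, f s = unital_norm mul one L s.

Definition lreg (m : nat) (mul : 'cV[R]_m -> 'cV[R]_m -> 'cV[R]_m)
    (a : 'cV[R]_m) : 'M[R]_m :=
  \matrix_(i, j) (mul a (ebasis j)) i 0.

Definition lreg_selfadjoint (m : nat) (mul : 'cV[R]_m -> 'cV[R]_m -> 'cV[R]_m) : Prop :=
  forall a : 'cV[R]_m, exists b : 'cV[R]_m, (lreg mul a)^T = lreg mul b.

Definition algebra_epi (n m : nat)
    (mul : 'cV[R]_n -> 'cV[R]_n -> 'cV[R]_n) (one : 'cV[R]_n)
    (mul' : 'cV[R]_m -> 'cV[R]_m -> 'cV[R]_m) (one' : 'cV[R]_m)
    (W : 'M[R]_(m, n)) : Prop :=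
  [/\ W *m one = one',
      (forall x y, W *m mul x y = mul' (W *m x) (W *m y)) &
      (forall y : 'cV[R]_m, exists x : 'cV[R]_n, W *m x = y)].

End Algebras.

(* Main.v *)
Require Import Defs.
From HB Require Import structures.
From mathcomp Require Import all_boot all_order all_algebra.
From mathcomp Require Import fingroup perm.
From mathcomp Require Import all_classical all_reals all_analysis.
Import Order.TTheory GRing.Theory Num.Theory.
Import numFieldNormedType.Exports.
Local Open Scope ring_scope.
Set Implicit Arguments. Unset Strict Implicit.
Unset Printing Implicit Defensive.

(**
For the first part, let [rep s] be the matrix of left multiplication by [W s].
The trace form [L = (|1|^2 / m) [tr (rep (e_i e_j))]] works: the derivative of
[(L s^-1)_j] along [e_k] is [- (|1|^2 / m) tr (rep (e_j s^-1 e_k s^-1))], which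
is symmetric in [j] and [k] by cyclicity of the trace, and the 1-form
[(L s^-1) . ds] is [|1|^2 / m] times the differential of [ln (det (rep s))] by
Jacobi's formula.

For the second part, a quotient algebra [B] of least positive dimension has no
proper nonzero two-sided ideal. Among all bases of [B], choose one minimizing
the sum of the squared Frobenius norms of the matrices [l_i], [r_i] that
represent the left and right multiplications by the elements of a basis fixed
once and for all. Limits of normalized changes of basis along which this sum
stays bounded have a two-sided ideal as kernel, hence are invertible, so the
minimum is attained. Stationarity reads [M_l + M_r = 0], where
[M_l = \sum_i (l_i l_i^T - l_i^T l_i)] and similarly for [M_r]. Since the [l_i]
commute with the [r_j],
[\sum_(i, j) |l_i^T r_j - r_j l_i^T|^2 = tr (M_r M_l) = - |M_l|^2], so both
sides vanish: each [l_i^T] commutes with all right multiplications, hence is a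
left multiplication. *)

(** * Entrywise continuity of matrix-valued functions *)

Section EntrywiseContinuity.
Variables (R : realType) (T : topologicalType) (x : T).

(** Continuity is taken at the single point [x], so that [mxcontV] needs invertibility only
    there. *)
Definition mxcont m n (f : T -> 'M[R]_(m, n)) : Prop :=
  forall i j, {for x, continuous (fun t => f t i j)}.

Lemma continuous_sum (I : Type) (r : seq I) (P : pred I) (F : I -> T -> R) :
  (forall i, {for x, continuous (F i)}) ->
  {for x, continuous (fun t => \sum_(i <- r | P i) F i t)}.
Proof.
move=> h; apply: cvg_big => [z|i _]; last exact: h.
by apply: cvgD; [exact: cvg_fst|exact: cvg_snd].
Qed.

Lemma continuous_prod (I : Type) (r : seq I) (P : pred I) (F : I -> T -> R) :
  (forall i, {for x, continuous (F i)}) ->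
  {for x, continuous (fun t => \prod_(i <- r | P i) F i t)}.
Proof.
move=> h; apply: cvg_big => [z|i _]; last exact: h.
by apply: cvgM; [exact: cvg_fst|exact: cvg_snd].
Qed.

Lemma continuous_ext (f g : T -> R) : f =1 g ->
  {for x, continuous f} -> {for x, continuous g}.
Proof. by move=> /funext ->. Qed.

Lemma mxcont_cst m n (A : 'M[R]_(m, n)) : mxcont (fun=> A).
Proof. by move=> i j; exact: cvg_cst. Qed.

Lemma mxcontD m n (f g : T -> 'M[R]_(m, n)) :
  mxcont f -> mxcont g -> mxcont (fun t => f t + g t).
Proof.
move=> cf cg i j; apply: (@continuous_ext (fun t => f t i j + g t i j)).
  by move=> t; rewrite mxE.
by apply: cvgD; [exact: cf|exact: cg].
Qed.

Lemma mxcontB m n (f g : T -> 'M[R]_(m, n)) :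
  mxcont f -> mxcont g -> mxcont (fun t => f t - g t).
Proof.
move=> cf cg i j; apply: (@continuous_ext (fun t => f t i j - g t i j)).
  by move=> t; rewrite !mxE.
by apply: cvgB; [exact: cf|exact: cg].
Qed.

Lemma mxcontM m n p (f : T -> 'M[R]_(m, n)) (g : T -> 'M[R]_(n, p)) :
  mxcont f -> mxcont g -> mxcont (fun t => f t *m g t).
Proof.
move=> cf cg i j.
apply: (@continuous_ext (fun t => \sum_k (f t i k * g t k j))).
  by move=> t; rewrite mxE.
by apply: continuous_sum => k; apply: cvgM; [exact: cf|exact: cg].
Qed.

Lemma mxcontZ m n (f : T -> R) (g : T -> 'M[R]_(m, n)) :
  {for x, continuous f} -> mxcont g -> mxcont (fun t => f t *: g t).
Proof.
move=> cf cg i j; apply: (@continuous_ext (fun t => f t * g t i j)).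
  by move=> t; rewrite mxE.
by apply: cvgM; [exact: cf|exact: cg].
Qed.

Lemma mxcont_tr m n (f : T -> 'M[R]_(m, n)) :
  mxcont f -> mxcont (fun t => (f t)^T).
Proof.
move=> cf i j; apply: (@continuous_ext (fun t => f t j i)) => // t.
by rewrite mxE.
Qed.

Lemma continuous_mxtrace n (f : T -> 'M[R]_n) :
  mxcont f -> {for x, continuous (fun t => \tr (f t))}.
Proof. by move=> cf; exact: continuous_sum. Qed.

Lemma continuous_det n (f : T -> 'M[R]_n) :
  mxcont f -> {for x, continuous (fun t => \det (f t))}.
Proof.
move=> cf; apply: continuous_sum => s; apply: cvgM; first exact: cvg_cst.
by apply: continuous_prod.
Qed.

(** Near [x] the determinant stays nonzero and the inverse is the adjugate divided by it; a
    neighborhood is needed because [invmx] returns singular matrices unchanged. *)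
Lemma mxcontV n (f : T -> 'M[R]_n) :
  mxcont f -> f x \in unitmx -> mxcont (fun t => invmx (f t)).
Proof.
move=> cf ux i j.
have cdet := continuous_det cf.
have dx : \det (f x) != 0 by rewrite -unitfE -unitmxE.
have cadj : mxcont (fun t => \adj (f t)).
  move=> k l.
  apply: (@continuous_ext
    (fun t => (-1) ^+ (l + k) * \det (row' l (col' k (f t))))).
    by move=> t; rewrite mxE.
  apply: cvgM; first exact: cvg_cst.
  apply: (@continuous_det _ (fun t => row' l (col' k (f t)))) => a b.
  apply: (@continuous_ext (fun t => f t (lift l a) (lift k b))) => // t.
  by rewrite !mxE.
rewrite /prop_for /continuous_at.
rewrite /invmx ux mxE.
apply: (cvg_trans (near_eq_cvg _)); last first.
  by apply: cvgM; [exact: (cvgV dx cdet)|exact: cadj].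
near=> t.
have dt : \det (f t) != 0.
  near: t; exact: (cvgr_neq0 (\det (f x))).
by rewrite unitmxE unitfE dt mxE.
Unshelve. all: by end_near. Qed.

End EntrywiseContinuity.

(** * Regular representation *)

Section AlgebraBasics.
Variable R : realType.

Lemma col_ebasis n (x : 'cV[R]_n) : x = \sum_j x j 0 *: ebasis R j.
Proof.
rewrite [LHS]matrix_sum_delta; apply: eq_bigr => j _.
by rewrite big_ord1.
Qed.

Lemma mulmx_ebasis m n (A : 'M[R]_(m, n)) j i : (A *m ebasis R j) i 0 = A i j.
Proof. by rewrite -colE mxE. Qed.

Lemma eq_mx_colP m n (A B : 'M[R]_(m, n)) :
  (forall x : 'cV[R]_n, A *m x = B *m x) -> A = B.
Proof.
move=> eqAB; apply/matrixP => i j.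
by rewrite -(mulmx_ebasis A) eqAB mulmx_ebasis.
Qed.

Lemma linear_form_ebasis n (f : 'cV[R]_n -> R) :
  (forall c x y, f (c *: x + y) = c * f x + f y) ->
  forall x, f x = \sum_i x i 0 * f (ebasis R i).
Proof.
move=> flin x; rewrite {1}(col_ebasis x).
have f0 : f 0 = 0.
  by have := flin (-1) 0 0; rewrite scaler0 addr0 mulN1r addNr.
have fD u v : f (u + v) = f u + f v by have := flin 1 u v; rewrite scale1r mul1r.
rewrite (big_morph f fD f0); apply: eq_bigr => i _.
by have := flin (x i 0) (ebasis R i) 0; rewrite f0 !addr0.
Qed.

Lemma mxcont_linear n p q (f : 'cV[R]_n -> 'M[R]_(p, q)) (x : 'cV[R]_n) :
  (forall c u v, f (c *: u + v) = c *: f u + f v) -> mxcont x f.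
Proof.
move=> flin i j; apply: (@continuous_ext R 'cV[R]_n x
    (fun t : 'cV[R]_n => \sum_k t k 0 * f (ebasis R k) i j)) => [t|].
  rewrite -(@linear_form_ebasis _ (fun x => f x i j))// => a u v.
  by rewrite flin !mxE.
apply: continuous_sum => k.
have ck : {for x, continuous (fun t : 'cV[R]_n => t k 0)}.
  exact: coord_continuous.
exact: (cvgM ck (cvg_cst _)).
Qed.

Variables (n : nat) (mul : 'cV[R]_n -> 'cV[R]_n -> 'cV[R]_n) (one : 'cV[R]_n).
Hypothesis alg : is_algebra mul one.

(** Right multiplications are left multiplications of the opposite algebra, so the lemmas on [lreg]
    serve both sides. *)
Lemma is_algebra_opp : is_algebra (fun x y => mul y x) one.
Proof.
by case: alg => n0 ml mr ma m1; split=> // x; case: (m1 x).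
Qed.

Lemma amulA x y z : mul x (mul y z) = mul (mul x y) z.
Proof. by case: alg. Qed.
Lemma amul1 x : mul one x = x. Proof. by case: alg => _ _ _ _ /(_ x)[]. Qed.
Lemma amulr1 x : mul x one = x. Proof. by case: alg => _ _ _ _ /(_ x)[]. Qed.
Lemma amulPr c x y a : mul a (c *: x + y) = c *: mul a x + mul a y.
Proof. by case: alg. Qed.
Lemma amulPl c x y a : mul (c *: x + y) a = c *: mul x a + mul y a.
Proof. by case: alg. Qed.
Lemma amul0r a : mul a 0 = 0.
Proof.
by have := amulPr (-1) 0 0 a; rewrite scaler0 addr0 scaleN1r addNr.
Qed.
Lemma amul0l a : mul 0 a = 0.
Proof.
by have := amulPl (-1) 0 0 a; rewrite scaler0 addr0 scaleN1r addNr.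
Qed.
Lemma amulDr a x y : mul a (x + y) = mul a x + mul a y.
Proof. by have := amulPr 1 x y a; rewrite !scale1r. Qed.
Lemma amulZr c a x : mul a (c *: x) = c *: mul a x.
Proof. by have := amulPr c x 0 a; rewrite amul0r !addr0. Qed.

Lemma one_neq0 : one != 0.
Proof.
apply/eqP => one0; case: alg => n0 _ _ _ _.
have := congr1 (fun v : 'cV[R]_n => v (Ordinal n0) 0) (amul1 (const_mx 1)).
by rewrite one0 amul0l !mxE => /esym/eqP; rewrite oner_eq0.
Qed.

Lemma mul_lreg a x : lreg mul a *m x = mul a x.
Proof.
rewrite {2}(col_ebasis x) (big_morph (mul a) (amulDr a) (amul0r a)).
apply/colP => i; rewrite mxE summxE; apply: eq_bigr => j _.
by rewrite amulZr !mxE mulrC.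
Qed.

Lemma lreg_mul a b : lreg mul (mul a b) = lreg mul a *m lreg mul b.
Proof. by apply: eq_mx_colP => x; rewrite -mulmxA !mul_lreg amulA. Qed.

Lemma lreg_one : lreg mul one = 1%:M.
Proof. by apply: eq_mx_colP => x; rewrite mul1mx mul_lreg amul1. Qed.

Lemma lreg_linear c x y : lreg mul (c *: x + y) = c *: lreg mul x + lreg mul y.
Proof.
apply: eq_mx_colP => z.
by rewrite mulmxDl -scalemxAl !mul_lreg amulPl.
Qed.

Lemma lreg_sum x : lreg mul x = \sum_i x i 0 *: lreg mul (ebasis R i).
Proof.
apply/matrixP => i j.
rewrite (@linear_form_ebasis _ (fun x => lreg mul x i j)) => [|c u v].
  by rewrite summxE; apply: eq_bigr => k _; rewrite [RHS]mxE.
by rewrite lreg_linear [LHS]mxE [X in X + _]mxE.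
Qed.

(** Surjectivity of [lreg mul s] only gives a right inverse; it is also a left one because one-sided
    inverses of square matrices are two-sided. *)
Lemma unit_lreg s : lreg mul s \in unitmx ->
  mul s (invmx (lreg mul s) *m one) = one /\
  mul (invmx (lreg mul s) *m one) s = one.
Proof.
move=> us; set t := _ *m one.
have st : mul s t = one by rewrite -mul_lreg mulKVmx.
split=> //; have := lreg_mul s t; rewrite st lreg_one => /esym /mulmx1C lts.
by rewrite -[LHS]amulr1 -mul_lreg lreg_mul lts mul1mx.
Qed.

(** Inverses are unique, so the choice made by [xget] reduces to a formula whose continuity in [s]
    is known. *)
Lemma ainvE s : lreg mul s \in unitmx ->
  ainv mul one s = invmx (lreg mul s) *m one.
Proof.
move=> us; have [st ts] := unit_lreg us; apply: xget_unique => // u [su us'].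
by rewrite -[LHS]amulr1 -[X in mul u X]st amulA us' amul1.
Qed.

Lemma amulVr s : lreg mul s \in unitmx -> mul s (ainv mul one s) = one.
Proof. by move=> us; rewrite ainvE// (unit_lreg us).1. Qed.

Lemma amulVl s : lreg mul s \in unitmx -> mul (ainv mul one s) s = one.
Proof. by move=> us; rewrite ainvE// (unit_lreg us).2. Qed.

(** The quotient by the ideal [ker W], carried to ['cV[R]_m] by the linear section [S]:
    representatives do not matter, as [x - S W x] lies in the ideal. An invertible [W] gives a
    change of basis. *)
Lemma quotient_algebra m (W : 'M[R]_(m, n)) (S : 'M[R]_(n, m)) :
  (0 < m)%N -> W *m S = 1%:M ->
  (forall x a, W *m x = 0 -> W *m mul x a = 0) ->
  (forall x a, W *m x = 0 -> W *m mul a x = 0) ->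
  is_algebra (fun u v => W *m mul (S *m u) (S *m v)) (W *m one) /\
  algebra_epi mul one (fun u v => W *m mul (S *m u) (S *m v)) (W *m one) W.
Proof.
move=> m0 WS idl idr.
have SW0 x : W *m (x - S *m (W *m x)) = 0.
  by rewrite mulmxBr !mulmxA WS mul1mx subrr.
have WSl x a : W *m mul (S *m (W *m x)) a = W *m mul x a.
  apply/eqP; rewrite eq_sym -subr_eq0 -mulmxBr; apply/eqP.
  have := amulPl (-1) (S *m (W *m x)) x a; rewrite !scaleN1r addrC => h.
  by rewrite addrC -h idl// SW0.
have WSr x a : W *m mul a (S *m (W *m x)) = W *m mul a x.
  apply/eqP; rewrite eq_sym -subr_eq0 -mulmxBr; apply/eqP.
  have := amulPr (-1) (S *m (W *m x)) x a; rewrite !scaleN1r addrC => h.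
  by rewrite addrC -h idr// SW0.
have KW x : W *m (S *m x) = x by rewrite mulmxA WS mul1mx.
split; split=> //.
- by move=> c x y a; rewrite mulmxDr -scalemxAr amulPl mulmxDr -scalemxAr.
- by move=> c x y a; rewrite mulmxDr -scalemxAr amulPr mulmxDr -scalemxAr.
- by move=> x y z; rewrite WSl WSr amulA.
- by move=> x; rewrite WSl WSr amul1 amulr1 KW.
- by move=> x y; rewrite WSl WSr.
- by move=> y; exists (S *m y); rewrite KW.
Qed.

End AlgebraBasics.

(** * Determinant norms *)

Section Jacobi.
Variable (R : realType).

(** A line of matrices with a formal parameter, so that its determinant is differentiated as a
    polynomial. *)
Definition pencil m (A B : 'M[R]_m) : 'M[{poly R}]_m :=
  map_mx polyC A + 'X *: map_mx polyC B.

Lemma horner_det_pencil m (A B : 'M[R]_m) t :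
  (\det (pencil A B)).[t] = \det (A + t *: B).
Proof.
rewrite -horner_evalE -det_map_mx; congr (\det _).
by apply/matrixP => i j; rewrite !mxE /= horner_evalE !hornerE.
Qed.

Lemma derivMX0 (u : {poly R}) : ('X * u)^`().[0] = u.[0].
Proof. by rewrite derivM derivX mul1r hornerD hornerM hornerX mul0r addr0. Qed.

Lemma deriv_prod_linear (I : Type) (r : seq I) (c : I -> R) :
  let p := \prod_(i <- r) (1 + 'X * (c i)%:P) in
  p.[0] = 1 /\ p^`().[0] = \sum_(i <- r) c i.
Proof.
elim: r => [|i r [p0 dp0]] /=; first by rewrite !big_nil -polyC1 derivC !hornerE.
have X0 : (1 + 'X * (c i)%:P).[0] = 1 by rewrite !hornerE.
rewrite !big_cons hornerM p0 X0 mulr1; split=> //.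
rewrite derivM hornerD !hornerM dp0 p0 X0 mul1r mulr1 derivD -polyC1 derivC add0r.
by rewrite derivMX0 hornerC.
Qed.

(** In the Leibniz expansion a nontrivial permutation moves some [i] and also [s i], so its term is
    divisible by ['X^2]; only the diagonal product contributes. *)
Lemma deriv_det_pencil1 m (B : 'M[R]_m) : (\det (pencil 1%:M B))^`().[0] = \tr B.
Proof.
have pE i j : pencil 1%:M B i j = (i == j)%:R + 'X * (B i j)%:P.
  by rewrite !mxE; case: eqP; rewrite ?polyC1 ?polyC0.
rewrite /determinant (bigD1 (1%g : {perm 'I_m}))//= derivD hornerD.
rewrite odd_perm1 expr0 mul1r.
rewrite [X in X + _ = _](_ : _ = \tr B); last first.
  rewrite (eq_bigr (fun i => 1 + 'X * (B i i)%:P)); last first.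
    by move=> i _; rewrite perm1 pE eqxx.
  exact: (deriv_prod_linear _ _).2.
rewrite (big_morph _ (@derivD R) (@deriv0 R)) horner_sum big1 ?addr0// => s s1.
have [i si] : exists i, s i != i.
  apply/existsP; apply: contraNT s1; rewrite negb_exists => /forallP fixs.
  by apply/eqP/permP => i; rewrite perm1; have /negPn/eqP := fixs i.
have sj : s (s i) != s i by rewrite (inj_eq perm_inj).
rewrite (bigD1 i)//= (bigD1 (s i))//= !pE.
rewrite eq_sym (negPf si) add0r [s i == _]eq_sym (negPf sj) add0r.
rewrite -!mulrA [(B i (s i))%:P * _]mulrCA [_ ^+ _ * _]mulrCA derivMX0.
by rewrite !hornerM hornerX mul0r !mulr0.
Qed.

(** Shifting the parameter by [t] and factoring out the invertible [A + t *: B] reduces the claim to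
    a pencil through the identity. *)
Lemma jacobi m (A B : 'M[R]_m) t : A + t *: B \in unitmx ->
  (\det (pencil A B))^`().[t] =
  \det (A + t *: B) * \tr (invmx (A + t *: B) *m B).
Proof.
set A0 := A + _ => uA.
have shift : (\det (pencil A B)) \Po ('X + t%:P) =
    (\det A0)%:P * \det (pencil 1%:M (invmx A0 *m B)).
  rewrite -[(\det A0)%:P]det_map_mx -det_mulmx -det_map_mx /pencil mulmxDr.
  rewrite map_mx1 mulmx1 -scalemxAr -map_mxM mulKVmx//.
  congr (\det _); apply/matrixP => i j; rewrite !mxE.
  rewrite /= comp_polyD comp_polyM !comp_polyC comp_polyX polyCD polyCM.
  by rewrite mulrDl addrA addrAC.
have := congr1 (fun q : {poly R} => q^`().[0]) shift.
rewrite /= deriv_comp derivD derivX derivC addr0 mulr1 horner_comp !hornerE.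
rewrite derivM derivC.
by rewrite !hornerE deriv_det_pencil1.
Qed.

End Jacobi.

(** * The integral of a logarithmic derivative *)

Section Integral.
Variables (R : realType) (m : nat) (N : 'M[R]_m).

(** By [jacobi] the integrand has the primitive [k * ln (\det (1%:M + t *: N))], which vanishes at
    0. *)
Lemma integral_dlogdet (k : R) :
  (forall t : R, 0 <= t <= 1 -> 0 < \det (1%:M + t *: N)) ->
  (\int[lebesgue_measure]_(t in `[0%R, 1%R])
     (k * \tr (invmx (1%:M + t *: N) *m N)))%R = k * ln (\det (1%:M + N)).
Proof.
move=> det_gt0.
pose p := \det (pencil 1%:M N).
have pE t : p.[t] = \det (1%:M + t *: N) by exact: horner_det_pencil.
pose f (t : R) : R := k * \tr (invmx (1%:M + t *: N) *m N).
pose F (t : R) : R := k * ln p.[t].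
have unit_t (t : R) : 0 <= t <= 1 -> 1%:M + t *: N \in unitmx.
  by move=> /det_gt0; rewrite unitmxE unitfE => /gt_eqF ->.
have dF (t : R) : 0 <= t <= 1 -> is_derive t (1 : R) F (f t).
  move=> t01; have pt0 : 0 < p.[t] by rewrite pE det_gt0.
  have := is_deriveZ k (is_derive1_comp (is_derive1_ln pt0) (is_derive_poly p t)).
  by rewrite [_ *: _](_ : _ = f t)// /f jacobi ?unit_t// -pE mulKf ?gt_eqF.
have cf (t : R) : 0 <= t <= 1 -> {for t, continuous f}.
  move=> t01; have cN : mxcont t (fun t : R => 1%:M + t *: N).
    apply: mxcontD; first exact: mxcont_cst.
    by apply: mxcontZ; [exact: cvg_id|exact: mxcont_cst].
  have ci := mxcontV cN (unit_t _ t01).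
  have ct : {for t, continuous (fun t : R => \tr (invmx (1%:M + t *: N) *m N))}.
    by apply: continuous_mxtrace; apply: mxcontM => //; exact: mxcont_cst.
  exact: (cvgM (cvg_cst _) ct).
have cF (t : R) : 0 <= t <= 1 -> (F x @[x --> t] --> F t)%classic.
  move=> /dF dFt; apply: differentiable_continuous.
  by apply/derivable1_diffP; case: dFt.
rewrite /Rintegral (@continuous_FTC2 _ f F)//.
- rewrite /F !pE scale1r scale0r addr0 det1 ln1 mulr0 /=.
  by rewrite subr0.
- apply: continuous_in_subspaceT => t; rewrite inE /= in_itv /=; exact: cf.
- split.
  + move=> t; rewrite in_itv /= => /andP[/ltW t0 /ltW t1].
    by have [] := dF t _; rewrite ?t0.
  + by apply: cvg_at_right_filter; apply: cF; rewrite lexx ler01.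
  + by apply: cvg_at_left_filter; apply: cF; rewrite lexx ler01.
- move=> t; rewrite in_itv /= => /andP[/ltW t0 /ltW t1].
  by rewrite derive1E; have [] := dF t _; rewrite ?t0.
Qed.

End Integral.

(** * The trace form and its unital norm *)

Section DeterminantNorm.
Variables (R : realType) (n m : nat).
Variables (mul : 'cV[R]_n -> 'cV[R]_n -> 'cV[R]_n) (one : 'cV[R]_n).
Variables (mul' : 'cV[R]_m -> 'cV[R]_m -> 'cV[R]_m) (one' : 'cV[R]_m).
Variable W : 'M[R]_(m, n).
Hypotheses (alg : is_algebra mul one) (alg' : is_algebra mul' one').
Hypothesis epi : algebra_epi mul one mul' one' W.

Let W1 : W *m one = one'. Proof. by case: epi. Qed.
Let WM x y : W *m mul x y = mul' (W *m x) (W *m y). Proof. by case: epi. Qed.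

Let rep x := lreg mul' (W *m x).

Let repP c x y : rep (c *: x + y) = c *: rep x + rep y.
Proof. by rewrite /rep mulmxDr -scalemxAr (lreg_linear alg'). Qed.

Let repM x y : rep (mul x y) = rep x *m rep y.
Proof. by rewrite /rep WM (lreg_mul alg'). Qed.

Let rep1 : rep one = 1%:M.
Proof. by rewrite /rep W1 (lreg_one alg'). Qed.

Let tau x := \tr (rep x).

Let tauP c x y : tau (c *: x + y) = c * tau x + tau y.
Proof. by rewrite /tau repP mxtraceD mxtraceZ. Qed.

Let tauC x y : tau (mul x y) = tau (mul y x).
Proof. by rewrite /tau !repM mxtrace_mulC. Qed.

Let m0 : m%:R != 0 :> R.
Proof. by case: alg' => m0 _ _ _ _; rewrite pnatr_eq0 -lt0n. Qed.

Let c := dotv one one.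

Let c0 : c != 0.
Proof.
apply: contra (one_neq0 alg) => c0; apply/eqP/colP => i; rewrite [RHS]mxE.
have sq0 : \sum_i one i 0 ^+ 2 = 0.
  transitivity c; last exact/eqP.
  by apply: eq_bigr => j _; rewrite expr2.
apply/eqP; rewrite -sqrf_eq0; apply/eqP.
by apply: (psumr_eq0P _ sq0) => // j _; exact: sqr_ge0.
Qed.

(** Since [tau one] is [m], the factor [c / m%:R] makes the form take the value [c] on a pair of
    inverse elements. *)
Let L : 'M[R]_n :=
  \matrix_(i, j) (c / m%:R * tau (mul (ebasis R i) (ebasis R j))).

Let L_mul x j : (L *m x) j 0 = c / m%:R * tau (mul (ebasis R j) x).
Proof.
rewrite (@linear_form_ebasis _ _ (fun x => tau (mul (ebasis R j) x))); last first.
  by move=> a u v; rewrite (amulPr alg) tauP.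
rewrite mxE mulr_sumr; apply: eq_bigr => k _.
by rewrite mxE -mulrA [tau _ * _]mulrC.
Qed.

Let L_dot x y : dotv (L *m x) y = c / m%:R * tau (mul x y).
Proof.
rewrite tauC (@linear_form_ebasis _ _ (fun y => tau (mul y x))); last first.
  by move=> a u v; rewrite (amulPl alg) tauP.
rewrite mulr_sumr; apply: eq_bigr => k _.
by rewrite L_mul -mulrA [tau _ * _]mulrC.
Qed.

Let L_sym : L^T = L.
Proof. by apply/matrixP => i j; rewrite !mxE tauC. Qed.

Let L_quad s x : (s^T *m L *m x) 0 0 = c / m%:R * tau (mul x s).
Proof.
rewrite -L_dot -mulmxA mxE; apply: eq_bigr => i _.
by rewrite mxE mulrC.
Qed.

(** With [a] and [b] the inverses of [s] and [h v + s], the resolvent identity [a - b = h b v a]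
    makes the difference quotient exactly [phi b]; continuity of inversion gives the limit. *)
Let derive_L_ainv s v j : lreg mul s \in unitmx ->
  'D_v (fun t : 'cV[R]_n => (L *m ainv mul one t) j 0) s =
  - (c / m%:R * tau (mul (ebasis R j)
      (mul (ainv mul one s) (mul v (ainv mul one s))))).
Proof.
move=> us; set a := ainv mul one s.
pose A (h : R) := invmx (lreg mul (h *: v + s)) *m one.
have cl : mxcont (0 : R) (fun h => lreg mul (h *: v + s)).
  rewrite (_ : (fun h : R => _) = (fun h => h *: lreg mul v + lreg mul s)).
    apply: mxcontD; last exact: mxcont_cst.
    by apply: mxcontZ; [exact: cvg_id|exact: mxcont_cst].
  by apply/funext => h; rewrite (lreg_linear alg).
have u0 : lreg mul ((0 : R) *: v + s) \in unitmx by rewrite scale0r add0r.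
have cA : mxcont (0 : R) A.
  by apply: mxcontM; [exact: mxcontV|exact: mxcont_cst].
pose phi y := - (c / m%:R * tau (mul (ebasis R j) (mul y (mul v a)))).
have phiP b x y : phi (b *: x + y) = b * phi x + phi y.
  by rewrite /phi (amulPl alg) (amulPr alg) tauP mulrDr opprD mulrN mulrCA.
have cphi : {for (0 : R), continuous (fun h => phi (A h))}.
  apply: (@continuous_ext _ _ _ (fun h => \sum_i A h i 0 * phi (ebasis R i))).
    by move=> h; rewrite -(linear_form_ebasis phiP).
  by apply: continuous_sum => i; apply: (cvgM (cA i 0) (cvg_cst _)).
have A0 : A 0 = a by rewrite /A /a (ainvE alg)// scale0r add0r.
have unear : \forall h \near (0 : R), lreg mul (h *: v + s) \in unitmx.
  have := continuous_det cl; rewrite /prop_for /continuous_at => cd.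
  have : \forall h \near (0 : R), \det (lreg mul (h *: v + s)) != 0.
    by apply: (cvgr_neq0 _ cd); rewrite -unitfE -unitmxE.
  by apply: filterS => h; rewrite unitmxE unitfE.
rewrite /derive; apply: cvg_lim => //.
have cphi' : (phi (A h) @[h --> 0^'] --> phi a)%classic.
  by rewrite -[in phi a]A0; apply/continuous_withinNx.
apply: cvg_trans cphi'; apply: near_eq_cvg.
near=> h.
have h0 : h != 0 by near: h; exact: nbhs_dnbhs_neq.
have uh : lreg mul (h *: v + s) \in unitmx.
  by near: h; exact: (cvg_within _ unear).
rewrite /A -(ainvE alg uh) /= !L_mul -/a.
set b := ainv mul one (h *: v + s).
have ab : a = h *: mul b (mul v a) + b.
  rewrite -[LHS](amul1 alg) -[X in mul X a = _](amulVl alg uh) -/b.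
  rewrite -(amulA alg) (amulPl alg) (amulPr alg) (amulVr alg us).
  by rewrite (amulr1 alg).
rewrite [in X in _ - X]ab (amulPr alg) tauP /phi.
rewrite mulrDr opprD addrCA subrr addr0 -[_ *: _]/(_ * _) mulrN.
by rewrite [c / _ * (h * _)]mulrCA mulKf.
Unshelve. all: by end_near. Qed.

Lemma special_unital_norm_det :
  special_unital_norm mul one
    (fun s : 'cV[R]_n => (\det (lreg mul' (W *m s))) `^ (m%:R^-1)).
Proof.
(* Both determinants equal 1 at [one], so nonvanishing and positivity persist nearby. *)
have near_good : \forall s \near one,
    lreg mul s \in unitmx /\ 0 < \det (rep s).
  have c1 := continuous_det (mxcont_linear (x := one) (lreg_linear alg)).
  have c2 := continuous_det (mxcont_linear (x := one) repP).
  have d1 : \det (lreg mul one) != 0 by rewrite (lreg_one alg) det1 oner_eq0.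
  have d2 : 0 < \det (rep one) by rewrite rep1 det1 ltr01.
  apply: filterS2 (cvgr_neq0 _ c1 d1) (cvgr_gt _ c2 _ d2) => s.
  by rewrite unitmxE unitfE.
exists L; split; first split.
- split=> //; have /nbhs_ballP[r r0 br] := near_good.
  exists r => // s /br[us _]; split.
    by exists (invmx (lreg mul s) *m one); exact: (unit_lreg alg us).
  move=> j k; rewrite !derive_L_ainv//; congr (- (_ * _)).
  by rewrite !(amulA alg) -(amulA alg) tauC !(amulA alg).
- apply: filterS near_good => s [us _].
  by rewrite L_quad tauC (amulVr alg us) /tau rep1 mxtrace1 mulfVK.
have /nbhs_ballP[r r0 br] := near_good.
apply/nbhs_ballP; exists r => // s bs.
pose st (t : R) := one + t *: (s - one).
have good_st (t : R) : 0 <= t <= 1 ->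
    lreg mul (st t) \in unitmx /\ 0 < \det (rep (st t)).
  move=> /andP[t0 t1]; apply: br; move: bs; rewrite -ball_normE /ball_/=.
  rewrite /st opprD addrA subrr add0r normrN normrZ distrC ger0_norm//.
  by apply: le_lt_trans; rewrite ler_piMl.
have rep_st t : rep (st t) = 1%:M + t *: rep (s - one).
  by rewrite /st addrC repP rep1 addrC.
have st1 : rep s = 1%:M + rep (s - one).
  by rewrite -[rep (s - one)]scale1r -rep_st /st scale1r addrC subrK.
rewrite /unital_norm -/c.
(* Since [rep] is multiplicative, it sends the inverse of [st t] to the inverse matrix, and the
   integrand becomes a logarithmic derivative. *)
have -> : (\int[lebesgue_measure]_(t in `[0%R, 1%R])
     dotv (L *m ainv mul one (one + t *: (s - one))) (s - one) =
   \int[lebesgue_measure]_(t in `[0%R, 1%R])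
     (c / m%:R * \tr (invmx (1%:M + t *: rep (s - one)) *m rep (s - one))))%R.
  apply: eq_Rintegral => t; rewrite inE /= in_itv /= => /good_st[us ds].
  rewrite -/(st t) L_dot /tau repM -rep_st; congr (_ * \tr (_ *m _)).
  have ur : rep (st t) \in unitmx by rewrite unitmxE unitfE gt_eqF.
  by rewrite -[LHS](mulmxK ur) -repM (amulVl alg us) rep1 mul1mx.
rewrite integral_dlogdet -?st1; last by move=> t /good_st[_]; rewrite rep_st.
(* On a positive base [powR] is [expR] of [m%:R^-1] times the logarithm; the factors [c] cancel. *)
rewrite /powR gt_eqF; last by have [] := br s bs.
by rewrite mulrA mulrA mulVf// mul1r.
Qed.

End DeterminantNorm.

(** * Minimal conjugates *)

Section Frobenius.
Variables (R : realType) (k : nat).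
Implicit Types A B : 'M[R]_k.

Let mxtraceB A B : \tr (A - B) = \tr A - \tr B. Proof. exact: raddfB. Qed.
Let mxtrB A B : (A - B)^T = A^T - B^T. Proof. exact: raddfB. Qed.

(** The squared Frobenius norm, as a trace so that cyclicity applies. *)
Definition sqn A : R := \tr (A^T *m A).

Lemma sqnE A : sqn A = \sum_j \sum_i A i j ^+ 2.
Proof.
apply: eq_bigr => j _; rewrite mxE; apply: eq_bigr => i _.
by rewrite mxE expr2.
Qed.

Lemma sqn_ge0 A : 0 <= sqn A.
Proof.
rewrite sqnE sumr_ge0// => j _.
by rewrite sumr_ge0// => i _; exact: sqr_ge0.
Qed.

Lemma entry_le_sqn A i j : A i j ^+ 2 <= sqn A.
Proof.
rewrite sqnE (bigD1 j)//= (bigD1 i)//= -addrA lerDl addr_ge0//.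
  by rewrite sumr_ge0// => a _; exact: sqr_ge0.
by rewrite sumr_ge0// => a _; rewrite sumr_ge0// => b _; exact: sqr_ge0.
Qed.

Lemma sqn_eq0 A : sqn A <= 0 -> A = 0.
Proof.
move=> A0; apply/matrixP => i j; rewrite mxE; apply/eqP.
by rewrite -sqrf_eq0 eq_le sqr_ge0 andbT (le_trans (entry_le_sqn A i j)).
Qed.

Lemma sqn0 : sqn 0 = 0.
Proof. by rewrite /sqn mulmx0 raddf0. Qed.

Lemma sqnZ c A : sqn (c *: A) = c ^+ 2 * sqn A.
Proof.
rewrite /sqn -scalemxAr [(_ *: A)^T]linearZ/= -scalemxAl scalerA mxtraceZ.
by rewrite expr2.
Qed.

Lemma sqnB A B : sqn A - sqn B = \tr ((A - B)^T *m (A + B)).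
Proof.
rewrite /sqn mxtrB mulmxBl !mulmxDr mxtraceB !mxtraceD -[\tr (A^T *m B)]mxtrace_tr.
by rewrite trmx_mul trmxK opprD addrA addrK.
Qed.

(** It vanishes exactly when [A] is normal; twice its sum over a family is the gradient at the
    identity of the total [sqn] under conjugation. *)
Definition selfcomm A : 'M[R]_k := A *m A^T - A^T *m A.

Lemma selfcomm_tr A : (selfcomm A)^T = selfcomm A.
Proof. by rewrite /selfcomm mxtrB !trmx_mul trmxK. Qed.

(** Of the four traces in the expansion, the two with a plus sign follow from cyclicity; the two
    with a minus sign also need [A] and [B] to commute. *)
Lemma sqn_comm_tr A B : A *m B = B *m A ->
  sqn (A^T *m B - B *m A^T) = \tr (selfcomm B *m selfcomm A).
Proof.
move=> AB; rewrite /sqn /selfcomm mxtrB !trmx_mul !trmxK.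
rewrite !mulmxBl !mulmxBr !mxtraceB.
have -> : \tr (B^T *m A *m (A^T *m B)) = \tr (B *m B^T *m (A *m A^T)).
  by rewrite -!mulmxA [RHS]mxtrace_mulC !mulmxA.
have -> : \tr (B^T *m A *m (B *m A^T)) = \tr (B^T *m B *m (A *m A^T)).
  by rewrite -!mulmxA [A *m (B *m _)]mulmxA AB !mulmxA.
have -> : \tr (A *m B^T *m (A^T *m B)) = \tr (B *m B^T *m (A^T *m A)).
  by rewrite mulmxA mxtrace_mulC !mulmxA -AB -!mulmxA mxtrace_mulC !mulmxA.
have -> : \tr (A *m B^T *m (B *m A^T)) = \tr (B^T *m B *m (A^T *m A)).
  by rewrite -!mulmxA mxtrace_mulC !mulmxA.
by rewrite !opprB addrACA [- _ - _]addrC addrACA.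
Qed.

(** The nonnegative [sqn] of the commutators add up to minus the [sqn] of the left sum, so each
    vanishes. *)
Lemma commuting_families p q (l : 'I_p -> 'M[R]_k) (r : 'I_q -> 'M[R]_k) :
  (forall i j, l i *m r j = r j *m l i) ->
  \sum_i selfcomm (l i) + \sum_j selfcomm (r j) = 0 ->
  forall i j, (l i)^T *m r j = r j *m (l i)^T.
Proof.
move=> lr /eqP; rewrite addr_eq0 => /eqP ML i j.
apply/eqP; rewrite -subr_eq0; apply/eqP/sqn_eq0.
have le0 : \sum_i \sum_j sqn ((l i)^T *m r j - r j *m (l i)^T) <= 0.
  rewrite (_ : \sum_i _ = - sqn (\sum_i selfcomm (l i))).
    by rewrite oppr_le0 sqn_ge0.
  rewrite /sqn (_ : (\sum_i selfcomm (l i))^T = \sum_i selfcomm (l i)).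
    rewrite {1}ML mulNmx raddfN/= opprK mulmx_sumr raddf_sum.
    apply: eq_bigr => a _; rewrite mulmx_suml raddf_sum.
    by apply: eq_bigr => b _; exact: (sqn_comm_tr (lr a b)).
  by rewrite linear_sum/=; apply: eq_bigr => a _; rewrite selfcomm_tr.
apply: le_trans le0.
rewrite (bigD1 i)//= (bigD1 j)//= -addrA lerDl addr_ge0//.
  by rewrite sumr_ge0// => a _; exact: sqn_ge0.
by rewrite sumr_ge0// => a _; rewrite sumr_ge0// => b _; exact: sqn_ge0.
Qed.

(** First variation along [1 - e M], the direction of steepest descent: the rate [- 2 sqn M] would
    be negative unless [M = 0]. *)
Lemma conj_minimum_critical p (c : 'I_p -> 'M[R]_k) :
  (forall g, g \in unitmx ->
     \sum_i sqn (c i) <= \sum_i sqn (g *m c i *m invmx g)) ->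
  \sum_i selfcomm (c i) = 0.
Proof.
move=> minc; set M := \sum_i _.
pose g e : 'M[R]_k := 1%:M - e *: M.
pose cg e i := g e *m c i *m invmx (g e).
(* [phi e] is the difference quotient of [\sum_i sqn (cg e i)] at 0; it is
   nonnegative for small [e > 0] and tends to [- 2 (sqn M)]. *)
pose phi e := \sum_i \tr (((c i *m M - M *m c i) *m invmx (g e))^T
                          *m (cg e i + c i)).
have g0 : g 0 = 1%:M by rewrite /g scale0r subr0.
have ug0 : g 0 \in unitmx by rewrite g0 unitmx1.
have cg0 : mxcont (0 : R) g.
  apply: mxcontB; first exact: mxcont_cst.
  by apply: mxcontZ; [exact: cvg_id|exact: mxcont_cst].
have cV0 : mxcont (0 : R) (fun e => invmx (g e)) by exact: mxcontV.
have cphi : {for (0 : R), continuous phi}.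
  apply: continuous_sum => i; apply: continuous_mxtrace.
  apply: mxcontM.
    by apply: mxcont_tr; apply: mxcontM => //; exact: mxcont_cst.
  apply: mxcontD; last exact: mxcont_cst.
  by apply: mxcontM => //; apply: mxcontM => //; exact: mxcont_cst.
have phi0 : phi 0 = - (sqn M *+ 2).
  have MT : M^T = M.
    by rewrite linear_sum/=; apply: eq_bigr => i _; rewrite selfcomm_tr.
  transitivity (\sum_i (- (\tr (M *m selfcomm (c i)) *+ 2))).
    apply: eq_bigr => i _.
    rewrite /cg g0 invmx1 !mulmx1 mul1mx -mulr2n raddfMn/= raddfMn/= -mulNrn.
    congr (_ *+ 2); rewrite mxtrB !trmx_mul MT mulmxBl mxtraceB.
    rewrite /selfcomm mulmxBr mxtraceB opprB.
    by rewrite -!mulmxA [in X in _ - X = _]mxtrace_mulC !mulmxA.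
  have <- : \tr (M *m \sum_i selfcomm (c i)) = sqn M by rewrite /sqn MT.
  by rewrite mulmx_sumr raddf_sum sumrN -sumrMnl.
apply: sqn_eq0; rewrite -oppr_ge0.
suff : 0 <= phi 0 by rewrite phi0 -mulNrn pmulrn_lge0.
have ug : \forall e \near (0 : R), g e \in unitmx.
  have := continuous_det cg0; rewrite /prop_for /continuous_at => h.
  have : \forall e \near (0 : R), \det (g e) != 0.
    by apply: (cvgr_neq0 _ h); rewrite -unitfE -unitmxE.
  by apply: filterS => e; rewrite unitmxE unitfE.
have cvphi : (phi e @[e --> 0^'+] --> phi 0)%classic.
  exact: cvg_at_right_filter.
have -> : phi 0 = lim (phi e @[e --> 0^'+])%classic by apply/esym/cvg_lim.
apply: limr_ge; first by apply/cvg_ex; exists (phi 0).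
near=> e.
have e0 : 0 < e by [].
have ue : g e \in unitmx by near: e; exact: (cvg_within _ ug).
have := minc _ ue; rewrite -subr_ge0 -sumrB.
rewrite (_ : \sum_i _ = e * phi e); first by rewrite pmulr_rge0.
rewrite mulr_sumr; apply: eq_bigr => i _.
(* Since [g e] is the identity minus [e *: M], the difference [cg e i - c i] is [e] times
   [c i M - M c i], multiplied on the right by the inverse of [g e]. *)
rewrite sqnB -/(cg e i) -mxtraceZ scalemxAl -linearZ/=; congr (\tr (_^T *m _)).
rewrite scalemxAl -[X in _ - X = _](mulmxK ue) -mulmxBl; congr (_ *m _).
rewrite /g mulmxBl mulmxBr mul1mx mulmx1 -scalemxAl -scalemxAr scalerBr.
by rewrite opprB addrC addrA subrK.
Unshelve. all: by end_near. Qed.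

End Frobenius.

Lemma continuous_sqn (R : realType) k (T : topologicalType) (x : T)
    (f : T -> 'M[R]_k) :
  mxcont x f -> {for x, continuous (fun t => sqn (f t))}.
Proof.
by move=> cf; apply: continuous_mxtrace; apply: mxcontM => //; exact: mxcont_tr.
Qed.

(** * Existence of a minimal conjugate by compactness *)

Section ConjugationMinimum.
Variables (R : realType) (k p : nat) (b : 'I_p -> 'M[R]_k).
Hypothesis k0 : (0 < k)%N.
(** A Schur-type irreducibility: the relations make the kernel of [h] stable under every [b i]. *)
Hypothesis irr : forall (h : 'M[R]_k) (c : 'I_p -> 'M[R]_k), h != 0 ->
  (forall i, h *m b i = c i *m h) -> h \in unitmx.

(* A pair [(h, (c_i))] of a matrix and a family is flattened into a row vector,
   the only shape for which the library has Heine-Borel. *)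
Let V := 'rV[R]_(p.+1 * (k * k)).
Let block (x : V) (j : 'I_p.+1) : 'M[R]_k := vec_mx (row j (vec_mx x)).
Let pack (f : 'I_p.+1 -> 'M[R]_k) : V := mxvec (\matrix_j mxvec (f j)).

Let packK f j : block (pack f) j = f j.
Proof. by rewrite /block /pack mxvecK rowK mxvecK. Qed.

Let block_cont x0 j : mxcont x0 (fun x : V => block x j).
Proof.
move=> a c; apply: (@continuous_ext _ _ _
  (fun x : V => x 0 (mxvec_index j (mxvec_index a c)))).
  by move=> x; rewrite !mxE.
exact: coord_continuous.
Qed.

Let hd (x : V) := block x ord0.
Let tl (x : V) i := block x (lift ord0 i).
(** One continuous sum of squares whose nonpositivity encodes both [sqn (hd x) = 1] and all the
    intertwining relations. *)
Let defect (x : V) :=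
  (sqn (hd x) - 1) ^+ 2 + \sum_i sqn (hd x *m b i - tl x i *m hd x).
Let tails (x : V) := \sum_i sqn (tl x i).
Let C := \sum_i sqn (b i).
(* Replacing [c_i = h b_i h^-1] by [h b_i = c_i h] keeps [K] closed; [irr]
   restores the invertibility of [h]. *)
Let K : set V := [set x | defect x <= 0 /\ tails x <= C]%classic.

Let cont_tails : continuous tails.
Proof.
move=> x; apply: continuous_sum => i; apply: continuous_sqn; exact: block_cont.
Qed.

Let cont_defect : continuous defect.
Proof.
move=> x.
have c1 : {for x, continuous (fun x : V => sqn (hd x))}.
  by apply: continuous_sqn; exact: block_cont.
have c2 : {for x, continuous (fun x : V => sqn (hd x) - 1)}.
  exact: (cvgB c1 (cvg_cst _)).
have c3 : {for x, continuous (fun x : V => (sqn (hd x) - 1) ^+ 2)}.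
  apply: (@continuous_ext _ _ _ (fun x : V => (sqn (hd x) - 1) * (sqn (hd x) - 1))).
    by move=> t; rewrite expr2.
  exact: (cvgM c2 c2).
apply: (cvgD c3).
apply: continuous_sum => i; apply: continuous_sqn; apply: mxcontB.
  by apply: mxcontM; [exact: block_cont|exact: mxcont_cst].
by apply: mxcontM; exact: block_cont.
Qed.

Let KP x : K x <->
  [/\ sqn (hd x) = 1, forall i, hd x *m b i = tl x i *m hd x & tails x <= C].
Proof.
have d0 : 0 <= \sum_i sqn (hd x *m b i - tl x i *m hd x).
  by apply: sumr_ge0 => i _; exact: sqn_ge0.
split=> [[dx sx]|[h1 hb sx]]; last first.
  split=> //; rewrite /defect h1 subrr expr0n add0r big1// => i _.
  by rewrite hb subrr sqn0.
have : defect x == 0 by rewrite eq_le dx addr_ge0// sqr_ge0.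
rewrite paddr_eq0 ?sqr_ge0// sqrf_eq0 subr_eq0 => /andP[/eqP h1 /eqP hb].
split=> // i; apply/eqP; rewrite -subr_eq0; apply/eqP/sqn_eq0.
by rewrite (psumr_eq0P _ hb)// => j _; exact: sqn_ge0.
Qed.

Let compactK : compact K.
Proof.
apply: bounded_closed_compact; last first.
  have cld (f : V -> R) (c : R) : continuous f -> closed [set x | f x <= c]%classic.
    by move=> /continuous_closedP cf; have := cf _ (@closed_le R c); exact.
  exact: closedI (cld _ 0 cont_defect) (cld _ C cont_tails).
have C0 : 0 <= C by apply: sumr_ge0 => i _; exact: sqn_ge0.
(* Every entry has square at most [1 + C], as the head has [sqn] 1 and the tails total at most [C];
   being at least 1, this also bounds the absolute value. *)
exists (1 + C); split; first exact: num_real.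
move=> r Cr x /KP[h1 _ sx].
have sq_le (a : R) : a ^+ 2 <= 1 + C -> `|a| <= r.
  move=> aC; rewrite leNgt; apply/negP => ra.
  have a1 : 1 + C < `|a| by exact: lt_trans ra.
  have : `|a| < `|a| ^+ 2.
    have a2 : 1 < `|a| by apply: le_lt_trans a1; rewrite lerDl.
    by rewrite expr2 ltr_pMr // (lt_trans ltr01).
  rewrite real_normK ?num_real// => /lt_le_trans /(_ aC) /(lt_trans a1).
  by rewrite ltxx.
rewrite /= [leLHS]/Num.Def.normr/= mx_normrE.
apply: bigmax_le => [|[i l] _ /=].
  by rewrite (le_trans _ (ltW Cr))// addr_ge0.
rewrite ord1; case/mxvec_indexP: l => j l; case/mxvec_indexP: l => u v.
rewrite (_ : x 0 _ = block x j u v); last by rewrite !mxE.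
apply: sq_le; apply: le_trans (entry_le_sqn _ _ _) _.
case: (unliftP ord0 j) => [i' ->|->]; last first.
  by rewrite -/(hd x) h1 lerDl.
rewrite -/(tl x i'); apply: le_trans (le_trans sx _); last by rewrite lerDr.
by rewrite /tails (bigD1 i')//= lerDl sumr_ge0// => a _; exact: sqn_ge0.
Qed.

(** Scaling [g] does not change conjugation, so every conjugate of total at most [C] is represented
    in [K]. Here [k0] ensures that an invertible [g] is nonzero. *)
Let normalize (g : 'M[R]_k) : g \in unitmx ->
  \sum_i sqn (g *m b i *m invmx g) <= C ->
  K (pack (fun j => if unlift ord0 j is Some i then g *m b i *m invmx g
                    else (Num.sqrt (sqn g))^-1 *: g)).
Proof.
move=> ug gC; apply/KP.
have g0 : 0 < sqn g.
  rewrite lt_neqAle sqn_ge0 andbT eq_sym; apply/eqP => g0.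
  have gz : g = 0 by apply: sqn_eq0; rewrite g0.
  have := congr1 (fun A : 'M[R]_k => A (Ordinal k0) (Ordinal k0)) (mulmxV ug).
  by rewrite gz mul0mx !mxE eqxx => /esym/eqP; rewrite oner_eq0.
rewrite /hd packK unlift_none; split.
- by rewrite sqnZ exprVn sqr_sqrtr ?ltW// mulVf ?gt_eqF.
- by move=> i; rewrite /tl packK liftK -scalemxAl -scalemxAr mulmxKV.
- by rewrite /tails; under eq_bigr do rewrite /tl packK liftK.
Qed.

(** A minimizer of [tails] over [K] has an invertible head, so its tails form a conjugate of [b];
    conjugates of total above [C] escape [K] but cannot do better. *)
Lemma exists_conj_minimum : exists g : 'M[R]_k, g \in unitmx /\
  \sum_i selfcomm (g *m b i *m invmx g) = 0.
Proof.
have [x Kx minx] : exists2 c, c \in K & forall t, t \in K -> tails c <= tails t.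
  apply: EVT_min_rV => //; last exact: continuous_subspaceT.
  eexists; apply: (normalize (unitmx1 _ _)).
  by rewrite /C; under eq_bigr do rewrite invmx1 mulmx1 mul1mx.
move: Kx; rewrite inE => /KP[h1 hb sx].
have uh : hd x \in unitmx.
  apply: (irr _ hb); apply/eqP => h0.
  by move: h1; rewrite h0 sqn0 => /esym/eqP; rewrite oner_eq0.
exists (hd x); split=> //.
have cE i : hd x *m b i *m invmx (hd x) = tl x i by rewrite hb mulmxK.
apply: conj_minimum_critical => g ug.
under eq_bigr do rewrite cE.
have ugh : g *m hd x \in unitmx by rewrite unitmx_mul ug.
have gE i : g *m (hd x *m b i *m invmx (hd x)) *m invmx g =
            g *m hd x *m b i *m invmx (g *m hd x).
  rewrite -[LHS](mulmxK ugh) !mulmxA; congr (_ *m _).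
  by rewrite (mulmxKV ug) (mulmxKV uh).
under [leRHS]eq_bigr do rewrite gE.
have [gC|Cg] := leP (\sum_i sqn (g *m hd x *m b i *m invmx (g *m hd x))) C.
  have := minx _ (mem_set (normalize ugh gC)); rewrite {2}/tails.
  by under [leRHS]eq_bigr do rewrite /tl packK liftK.
exact: le_trans sx (ltW Cg).
Qed.

End ConjugationMinimum.

(** * Self-adjoint quotients *)

Section SelfAdjointQuotient.
Variable R : realType.

Lemma algebra_epi_id n (mul : 'cV[R]_n -> 'cV[R]_n -> 'cV[R]_n) one :
  algebra_epi mul one mul one 1%:M.
Proof.
split; first by rewrite mul1mx.
- by move=> x y; rewrite !mul1mx.
- by move=> y; exists y; rewrite mul1mx.
Qed.

Lemma algebra_epi_comp n m l
    (mul : 'cV[R]_n -> 'cV[R]_n -> 'cV[R]_n) one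
    (mul' : 'cV[R]_m -> 'cV[R]_m -> 'cV[R]_m) one'
    (mul'' : 'cV[R]_l -> 'cV[R]_l -> 'cV[R]_l) one'' W W' :
  algebra_epi mul one mul' one' W -> algebra_epi mul' one' mul'' one'' W' ->
  algebra_epi mul one mul'' one'' (W' *m W).
Proof.
move=> [W1 WM Ws] [W1' WM' Ws']; split; first by rewrite -mulmxA W1.
- by move=> x y; rewrite -!mulmxA WM WM'.
- by move=> y; have [z <-] := Ws' y; have [x <-] := Ws z; exists x; rewrite mulmxA.
Qed.

(** Two-sided ideals are encoded as kernels of square matrices: [h != 0] makes the ideal proper, and
    [h \in unitmx] makes it zero. *)
Definition simple_algebra m (mul : 'cV[R]_m -> 'cV[R]_m -> 'cV[R]_m) : Prop :=
  forall h : 'M[R]_m, h != 0 ->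
    (forall x a, h *m x = 0 -> h *m mul x a = 0 /\ h *m mul a x = 0) ->
    h \in unitmx.

Lemma exists_simple_quotient n (mul : 'cV[R]_n -> 'cV[R]_n -> 'cV[R]_n) one :
  is_algebra mul one ->
  exists m (mul' : 'cV[R]_m -> 'cV[R]_m -> 'cV[R]_m) one' W,
    [/\ is_algebra mul' one', algebra_epi mul one mul' one' W &
        simple_algebra mul'].
Proof.
move=> alg.
pose P m := `[< exists (mul' : 'cV[R]_m -> 'cV[R]_m -> 'cV[R]_m) one' W,
    is_algebra mul' one' /\ algebra_epi mul one mul' one' W >].
have exP : exists m, P m.
  exists n; apply/asboolP; exists mul, one, 1%:M; split => //.
  exact: algebra_epi_id.
case: (ex_minnP exP) => m /asboolP[mul' [one' [W [alg' epi]]]] minm.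
exists m, mul', one', W; split=> // h h0 hideal.
rewrite -row_free_unit -row_leq_rank leqNgt; apply/negP => rm.
have r0 : (0 < \rank h)%N by rewrite lt0n mxrank_eq0.
(* [row_base h] has the kernel of [h] and full row rank, so it serves as quotient map onto an
   algebra of dimension [\rank h], below the minimum. *)
have WS : row_base h *m pinvmx (row_base h) = 1%:M.
  exact/mulmxVp/row_base_free.
have rbE : row_base h = pinvmx (col_base h) *m h.
  transitivity (pinvmx (col_base h) *m (col_base h *m row_base h)).
    by rewrite mulmxA (mulVpmx (col_base_full h)) mul1mx.
  by rewrite mulmx_base.
have kerE (x : 'cV[R]_m) : row_base h *m x = 0 <-> h *m x = 0.
  split=> hx; first by rewrite -(mulmx_base h) -mulmxA hx mulmx0.
  by rewrite rbE -mulmxA hx mulmx0.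
have [alg2 epi2] := quotient_algebra alg' r0 WS
  (fun x a hx => proj2 (kerE _) (hideal x a (proj1 (kerE x) hx)).1)
  (fun x a hx => proj2 (kerE _) (hideal x a (proj1 (kerE x) hx)).2).
have : (m <= \rank h)%N.
  apply: minm; apply/asboolP; do 3 eexists; split; first exact: alg2.
  exact: algebra_epi_comp epi epi2.
by rewrite leqNgt rm.
Qed.

Lemma simple_algebra_selfadjoint m
    (mul : 'cV[R]_m -> 'cV[R]_m -> 'cV[R]_m) one :
  is_algebra mul one -> simple_algebra mul ->
  exists (mul' : 'cV[R]_m -> 'cV[R]_m -> 'cV[R]_m) one' W,
    [/\ is_algebra mul' one', lreg_selfadjoint mul' &
        algebra_epi mul one mul' one' W].
Proof.
move=> alg simple; have m0 : (0 < m)%N by case: alg.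
pose rmul x y := mul y x.
have algo : is_algebra rmul one := is_algebra_opp alg.
pose L i := lreg mul (ebasis R i).
pose Q i := lreg rmul (ebasis R i).
pose b (i : 'I_(m + m)) :=
  match fintype.split i with inl i => L i | inr i => Q i end.
have bL i : b (lshift m i) = L i by rewrite /b (unsplitK (inl i)).
have bQ i : b (rshift m i) = Q i by rewrite /b (unsplitK (inr i)).
(* The kernel of such an [h] is stable under all left and right multiplications, hence a two-sided
   ideal. *)
have irr (h : 'M[R]_m) c : h != 0 -> (forall i, h *m b i = c i *m h) ->
    h \in unitmx.
  move=> h0 hb; apply: simple => // x a hx; split.
    rewrite -[mul x a]/(rmul a x) -(mul_lreg algo) (lreg_sum algo).
    rewrite mulmx_suml mulmx_sumr big1// => i _.
    rewrite -scalemxAl -scalemxAr mulmxA -/(Q i) -bQ hb -mulmxA hx.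
    by rewrite mulmx0 scaler0.
  rewrite -(mul_lreg alg) (lreg_sum alg) mulmx_suml mulmx_sumr big1// => i _.
  rewrite -scalemxAl -scalemxAr mulmxA -/(L i) -bL hb -mulmxA hx.
  by rewrite mulmx0 scaler0.
have [g [ug]] := exists_conj_minimum m0 irr.
rewrite big_split_ord/=.
under eq_bigr do rewrite bL.
under [X in _ + X = _]eq_bigr do rewrite bQ.
move=> crit.
have lr i j : L i *m Q j = Q j *m L i.
  apply: eq_mx_colP => x.
  by rewrite -!mulmxA !(mul_lreg alg, mul_lreg algo) (amulA alg).
have glr i j : (g *m L i *m invmx g) *m (g *m Q j *m invmx g) =
               (g *m Q j *m invmx g) *m (g *m L i *m invmx g).
  by rewrite !mulmxA !(mulmxKV ug) -[g *m L i *m _]mulmxA lr mulmxA.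
have comm := commuting_families glr crit.
have ginj x : g *m x = 0 -> x = 0.
  by move=> gx; rewrite -[x](mulKmx ug) gx mulmx0.
(* The same algebra after the change of basis [g], which conjugates all multiplications by [g]. *)
have [] := quotient_algebra alg m0 (mulmxV ug).
- by move=> x a /ginj ->; rewrite (amul0l alg) mulmx0.
- by move=> x a /ginj ->; rewrite (amul0r alg) mulmx0.
set mul' := (fun u v => _); set one' := g *m one => alg' epi.
exists mul', one', g; split=> //.
have lregE a : lreg mul' a = g *m lreg mul (invmx g *m a) *m invmx g.
  by apply: eq_mx_colP => x; rewrite (mul_lreg alg') -!mulmxA (mul_lreg alg).
have rregE a x : mul' x a = g *m lreg rmul (invmx g *m a) *m invmx g *m x.
  by rewrite -!mulmxA (mul_lreg algo).
have conj_sum (I : finType) (c : I -> R) (A : I -> 'M[R]_m) :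
    g *m (\sum_i c i *: A i) *m invmx g = \sum_i c i *: (g *m A i *m invmx g).
  rewrite mulmx_sumr mulmx_suml; apply: eq_bigr => i _.
  by rewrite -scalemxAr -scalemxAl.
(* Bilinearity extends [comm] from basis elements to all elements. *)
have commL d a :
    (g *m lreg mul d *m invmx g)^T *m (g *m lreg rmul a *m invmx g) =
    (g *m lreg rmul a *m invmx g) *m (g *m lreg mul d *m invmx g)^T.
  rewrite (lreg_sum alg d) (lreg_sum algo a) !conj_sum.
  rewrite [(\sum_i _)^T]raddf_sum/= mulmx_suml mulmx_sumr.
  apply: eq_bigr => i _; rewrite [(_ *: _)^T]linearZ/= mulmx_sumr mulmx_suml.
  apply: eq_bigr => j _.
  by rewrite -!scalemxAl -!scalemxAr comm !scalerA mulrC.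
(* The transpose [T] commutes with right multiplications, so [T x = T (1 x) = (T 1) x]: it is left
   multiplication by [T 1]. *)
move=> a; exists ((lreg mul' a)^T *m one'); apply: eq_mx_colP => x.
rewrite (mul_lreg alg') rregE mulmxA [in RHS]lregE -commL -lregE -mulmxA.
by rewrite -rregE (amul1 alg').
Qed.

End SelfAdjointQuotient.

Theorem theorem8p3 (R : realType) :
  (forall (n m : nat)
     (mul : 'cV[R]_n -> 'cV[R]_n -> 'cV[R]_n) (one : 'cV[R]_n)
     (mul' : 'cV[R]_m -> 'cV[R]_m -> 'cV[R]_m) (one' : 'cV[R]_m)
     (W : 'M[R]_(m, n)),
     is_algebra mul one -> is_algebra mul' one' -> lreg_selfadjoint mul' ->
     algebra_epi mul one mul' one' W ->
     special_unital_norm mul one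
       (fun s : 'cV[R]_n => (\det (lreg mul' (W *m s))) `^ (m%:R^-1)))
  /\
  (forall (n : nat) (mul : 'cV[R]_n -> 'cV[R]_n -> 'cV[R]_n) (one : 'cV[R]_n),
     is_algebra mul one ->
     exists (m : nat) (mul' : 'cV[R]_m -> 'cV[R]_m -> 'cV[R]_m) (one' : 'cV[R]_m)
            (W : 'M[R]_(m, n)),
       [/\ is_algebra mul' one', lreg_selfadjoint mul' &
           algebra_epi mul one mul' one' W]).
Proof.
split=> [n m mul one mul' one' W alg alg' _ epi|n mul one alg].
  exact: special_unital_norm_det alg alg' epi.
have [m [mul1 [one1 [W1 [alg1 epi1 simple1]]]]] := exists_simple_quotient alg.
have [mul2 [one2 [W2 [alg2 sa2 epi2]]]] :=
  simple_algebra_selfadjoint alg1 simple1.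
exists m, mul2, one2, (W2 *m W1); split=> //.
exact: algebra_epi_comp epi1 epi2.
Qed.
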